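(* Let $(A,\cdot_A)$ be an associative algebra over $\mathbb{K}$ and $\lambda\in\mathbb{K}$. Then $\left(\bigoplus_{n=0}^{+\infty}\mathrm{Hom}(\otimes^{n+1}A,A),l_0,l_1,l_2\right)$ is a curved $L_\infty$-algebra (with $l_k=0$ for $k\ge3$), where $l_0\in\mathrm{Hom}(\otimes^2A,A)$ is given by $l_0(x,y)=\lambda(x\cdot_Ay)$, $l_1=0$, and $$\begin{aligned} &l_2(f,g)(x_1,\dots,x_{m+n})\\ =&\,(-1)^{m-1}g(x_1,\dots,x_n)\cdot_Af(x_{n+1},\dots,x_{m+n})+(-1)^{m(n-1)}f(x_1,\dots,x_m)\cdot_Ag(x_{m+1},\dots,x_{m+n})\\ &-\sum_{i=1}^m(-1)^{in}(-1)^mf(x_1,\dots,x_{i-1},x_i\cdot_Ag(x_{i+1},\dots,x_{i+n}),x_{i+n+1},\dots,x_{m+n})\\ &+\sum_{i=1}^m(-1)^{(i-1)n}(-1)^mf(x_1,\dots,x_{i-1},g(x_i,\dots,x_{i+n-1})\cdot_Ax_{i+n},x_{i+n+1},\dots,x_{m+n})\\ &-\sum_{i=1}^n(-1)^{(i-1)m}(-1)^{m(n-1)}g(x_1,\dots,x_{i-1},f(x_i,\dots,x_{i+m-1})\cdot_Ax_{i+m},x_{i+m+1},\dots,x_{m+n})\\ &+\sum_{i=1}^n(-1)^{(i-1)m}(-1)^{mn}g(x_1,\dots,x_{i-1},x_i\cdot_Af(x_{i+1},\dots,x_{i+m}),x_{i+m+1},\dots,x_{m+n}), \end{aligned}$$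 for all $f\in\mathrm{Hom}(\otimes^mA,A)$, $g\in\mathrm{Hom}(\otimes^nA,A)$ and $x,y,x_1,\dots,x_{m+n}\in A$. Moreover, the Maurer-Cartan elements of this curved $L_\infty$-algebra are exactly the modified Rota-Baxter operators of weight $\lambda$ on $(A,\cdot_A)$.
   Context: All vector spaces are over a field $\mathbb{K}$ of characteristic $0$; associative algebras are not assumed unital. $\mathrm{Hom}(\otimes^{n+1}A,A)$ is placed in degree $n$. A modified Rota-Baxter operator of weight $\lambda$ on $(A,\cdot_A)$ is a linear map $D:A\to A$ with $D(x)\cdot_AD(y)-D(x\cdot_AD(y))-D(D(x)\cdot_Ay)=-\lambda(x\cdot_Ay)$ for all $x,y\in A$. A curved $L_\infty$-algebra is a $\mathbb{Z}$-graded vector space $\mathfrak{g}$ with linear maps $l_k:\otimes^k\mathfrak{g}\to\mathfrak{g}$ ($k\ge0$) of degree $1$ that are graded symmetric, $l_n(x_{\sigma(1)},\dots,x_{\sigma(n)})=\varepsilon(\sigma)l_n(x_1,\dots,x_n)$ for $\sigma\in S_n$, and satisfy for all $n\ge0$: $\sum_{i=0}^n\sum_{\sigma\in S(i,n-i)}\varepsilon(\sigma)l_{n-i+1}(l_i(x_{\sigma(1)},\dots,x_{\sigma(i)}),x_{\sigma(i+1)},\dots,x_{\sigma(n)})=0$, where $\varepsilon(\sigma)$ is the Koszul sign, $S(i,n-i)$ is the set of $(i,n-i)$-shuffles, and the $x_j$ are homogeneous. A Maurer-Cartan element is a degree $0$ element $x$ with $l_0+\sum_{k\ge1}\frac{1}{k!}l_k(x,\dots,x)=0$.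 (In the paper this curved $L_\infty$-algebra is the one associated with the quasi-twilled associative algebra $(A\oplus_MA,A,A)$, where $(x,u)\cdot_M(y,v)=(x\cdot_Av+u\cdot_Ay,\lambda(x\cdot_Ay)+u\cdot_Av)$.) *)

(* Defs.v *)
From HB Require Import structures.
From mathcomp Require Import all_boot all_order all_algebra all_fingroup.
From mathcomp Require Import boolp functions zify.

Set Implicit Arguments.
Unset Strict Implicit.
Unset Printing Implicit Defensive.

Import GRing.Theory.
Local Open Scope ring_scope.

(* [seq U] is the disjoint union of the powers U^k, so a function             *)
(* [F : seq U -> W] is a family, indexed by k >= 0, of functions U^k -> W.    *)
(* [multilinear F] says that each of them is k-linear, i.e. that F is a       *)
(* family of linear maps from the k-th tensor powers of U to W; for k = 0     *)
(* this is the choice of an element [F [::]] of W.                            *)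
Definition multilinear (K : fieldType) (U W : lmodType K) (F : seq U -> W) :=
  forall s t : seq U, linear (fun u => F (s ++ u :: t)).

(* [gr d] is the subspace of elements of degree d.                            *)
Record is_grading (K : fieldType) (V : lmodType K) (gr : int -> V -> Prop) :
    Prop := IsGrading {
  grading0 : forall d, gr d 0;
  gradingP : forall d (a : K) u v, gr d u -> gr d v -> gr d (a *: u + v);
  grading_span : forall v, exists (r : seq int) (c : int -> V),
    (forall d, gr d (c d)) /\ v = \sum_(d <- r) c d;
  grading_direct : forall (r : seq int) (c : int -> V), uniq r ->
    (forall d, gr d (c d)) -> \sum_(d <- r) c d = 0 ->
    forall d, d \in r -> c d = 0
}.

(* For homogeneous x_j of degree d_j, in the free graded commutative algebra, *)
(* x_0 ... x_(n-1) = koszul_sign d s * (x_(s 0) ... x_(s (n-1))).             *)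
Definition koszul_sign (K : fieldType) n (d : 'I_n -> int) (s : 'S_n) : K :=
  \prod_(a < n) \prod_(b < n | (a < b)%N && (s b < s a)%N)
     (-1) ^ (d (s a) * d (s b)).

(* (i, n - i)-shuffles: s is increasing on [0, i) and on [i, n).              *)
Definition is_shuffle n (i : nat) (s : 'S_n) : bool :=
  [forall a : 'I_n, forall b : 'I_n,
     (a < b)%N && ((b < i)%N || (i <= a)%N) ==> (s a < s b)%N].

(* The operations (l_k)_(k >= 0) are given as a single family                 *)
(* [l : seq V -> V]: l_k is the restriction of l to sequences of length k.    *)
Record curved_Linfty (K : fieldType) (V : lmodType K) (gr : int -> V -> Prop)
    (l : seq V -> V) : Prop := CurvedLinfty {
  Linfty_grading : is_grading gr;
  Linfty_multilinear : multilinear l;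
  Linfty_degree1 : forall n (x : 'I_n -> V) (d : 'I_n -> int),
    (forall j, gr (d j) (x j)) ->
    gr (\sum_(j < n) d j + 1) (l [seq x j | j : 'I_n]);
  Linfty_symmetric : forall n (x : 'I_n -> V) (d : 'I_n -> int) (s : 'S_n),
    (forall j, gr (d j) (x j)) ->
    l [seq x (s j) | j : 'I_n] = koszul_sign K d s *: l [seq x j | j : 'I_n];
  Linfty_relation : forall n (x : 'I_n -> V) (d : 'I_n -> int),
    (forall j, gr (d j) (x j)) ->
    \sum_(i < n.+1) \sum_(s : 'S_n | is_shuffle i s)
       koszul_sign K d s *:
         (let y := [seq x (s j) | j : 'I_n] in
          l (l (take i y) :: drop i y)) = 0
}.

(* The infinite sum is required to have only finitely many nonzero terms.     *)
Definition maurer_cartan (K : fieldType) (V : lmodType K)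
    (gr : int -> V -> Prop) (l : seq V -> V) (x : V) : Prop :=
  gr 0 x /\
  exists N : nat, (forall k, (N <= k)%N -> l (nseq k x) = 0) /\
    \sum_(k < N) (k`!%:R : K)^-1 *: l (nseq k x) = 0.

(* The direct sum of the spaces Hom(A^(tensor n+1), A), n >= 0: families of   *)
(* multilinear maps, with no component of arity 0 and only finitely many      *)
(* nonzero components.                                                        *)
Definition is_cochain (K : fieldType) (A : lmodType K) (F : seq A -> A) :=
  [/\ multilinear F, F [::] = 0
    & exists N : nat, forall s, (N < size s)%N -> F s = 0].

Definition cochain_pred (K : fieldType) (A : lmodType K) :
  {pred seq A -> A} := fun F => `[< is_cochain F >].

Section CochainSpace.
Variables (K : fieldType) (A : lmodType K).

Lemma cochain_submod_closed : submod_closed (@cochain_pred K A).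
Proof.
split.
  apply/asboolP; split=> [s t a u v|//|]; last by exists 0%N.
  by rewrite -[RHS]/(a *: 0 + 0 : A) scaler0 addr0.
move=> a F G /asboolP[mF F0 [N FN]] /asboolP[mG G0 [M GM]].
apply/asboolP; split=> [s t b u v||].
- rewrite -![(a *: F + G) _]/(a *: F _ + G _) mF mG !scalerDr !scalerA.
  by rewrite (mulrC b) addrACA.
- by rewrite -[(a *: F + G) _]/(a *: F _ + G _) F0 G0 scaler0 addr0.
- exists (maxn N M) => s; rewrite gtn_max => /andP[Ns Ms].
  by rewrite -[(a *: F + G) _]/(a *: F _ + G _) FN// GM// scaler0 addr0.
Qed.

HB.instance Definition _ :=
  GRing.isSubmodClosed.Build K (seq A -> A) (@cochain_pred K A)
    cochain_submod_closed.

Record cochain := Cochain {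
  cochain_val :> seq A -> A;
  cochain_valP : cochain_val \in @cochain_pred K A }.

HB.instance Definition _ := [isSub for cochain_val].
HB.instance Definition _ := [Choice of cochain by <:].
HB.instance Definition _ := [SubChoice_isSubLmodule of cochain by <:].

Lemma cochainP (F : cochain) : is_cochain F.
Proof. exact/asboolP/cochain_valP. Qed.

Definition mk_cochain (F : seq A -> A) (cF : is_cochain F) : cochain :=
  @Cochain F (asboolT cF).

(* Hom(A^(tensor n+1), A) is placed in degree n.                              *)
Definition cochain_degree (d : int) (F : cochain) : Prop :=
  forall s : seq A, (size s)%:Z <> d + 1 -> F s = 0.

End CochainSpace.

(* [entry s i] is x_i and [segment s i j] is (x_i, ..., x_j), with indices    *)
(* starting from 1, for s = (x_1, ..., x_N); the segment is empty if j < i.   *)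
Definition entry (A : nmodType) (s : seq A) (i : nat) : A := nth 0 s i.-1.
Definition segment (A : Type) (s : seq A) (i j : nat) : seq A :=
  drop i.-1 (take j s).

Definition l2_formula (K : fieldType) (A : lmodType K) (mul : A -> A -> A)
    (m n : nat) (f g : seq A -> A) (s : seq A) : A :=
  let x := entry s in
  let xs := segment s in
    (-1) ^+ (m - 1) *: mul (g (xs 1 n)) (f (xs n.+1 (m + n)))%N
  + (-1) ^+ (m * (n - 1)) *: mul (f (xs 1 m)) (g (xs m.+1 (m + n)))%N
  - \sum_(1 <= i < m.+1) ((-1) ^+ (i * n) * (-1) ^+ m) *:
      f (xs 1 (i - 1) ++ mul (x i) (g (xs i.+1 (i + n)))
           :: xs (i + n).+1 (m + n))%N
  + \sum_(1 <= i < m.+1) ((-1) ^+ ((i - 1) * n) * (-1) ^+ m) *: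
      f (xs 1 (i - 1) ++ mul (g (xs i (i + n - 1))) (x (i + n))
           :: xs (i + n).+1 (m + n))%N
  - \sum_(1 <= i < n.+1) ((-1) ^+ ((i - 1) * m) * (-1) ^+ (m * (n - 1))) *:
      g (xs 1 (i - 1) ++ mul (f (xs i (i + m - 1))) (x (i + m))
           :: xs (i + m).+1 (m + n))%N
  + \sum_(1 <= i < n.+1) ((-1) ^+ ((i - 1) * m) * (-1) ^+ (m * n)) *:
      g (xs 1 (i - 1) ++ mul (x i) (f (xs i.+1 (i + m)))
           :: xs (i + m).+1 (m + n))%N.

(* Bilinear extension of [l2_formula] to the direct sum; see [l2_homE].       *)
Definition l2_fun (K : fieldType) (A : lmodType K) (mul : A -> A -> A)
    (F G : seq A -> A) (s : seq A) : A :=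
  \sum_(1 <= m < size s) l2_formula mul m (size s - m) F G s.

(* The library's algebras are unital, so an associative algebra without unit  *)
(* is a K-module A with a bilinear product [mul] such that [associative mul]. *)
Section BracketIsCochain.
Variables (K : fieldType) (A : lmodType K).
Implicit Types (F G f g : seq A -> A) (s t : seq A).

Let ml_at N F := forall s t, (size s + (size t).+1)%N = N ->
  linear (fun u => F (s ++ u :: t)).

Let ml_atW N F : multilinear F -> ml_at N F.
Proof. by move=> mF s t _; apply: mF. Qed.

Let eq_ml_at N F G :
  (forall s, size s = N -> F s = G s) -> ml_at N F -> ml_at N G.
Proof.
move=> FG mF s t st a u v.
have szE w : size (s ++ w :: t) = N by rewrite size_cat.
by rewrite -!FG// mF.
Qed.

Let ml_at0 N : ml_at N (fun=> 0).
Proof. by move=> s t _ a u v; rewrite scaler0 addr0. Qed.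

Let ml_atD N F G : ml_at N F -> ml_at N G -> ml_at N (fun s => F s + G s).
Proof.
by move=> mF mG s t st a u v /=; rewrite mF// mG// scalerDr addrACA.
Qed.

Let ml_atZ N c F : ml_at N F -> ml_at N (fun s => c *: F s).
Proof.
by move=> mF s t st a u v; rewrite mF// scalerDr !scalerA mulrC.
Qed.

Let ml_atN N F : ml_at N F -> ml_at N (fun s => - F s).
Proof. by move=> mF s t st a u v; rewrite mF// opprD scalerN. Qed.

Let ml_at_sum N a b (H : nat -> seq A -> A) :
  (forall i, (a <= i < b)%N -> ml_at N (H i)) ->
  ml_at N (fun s => \sum_(a <= i < b) H i s).
Proof.
move=> mH s t st c u v; rewrite scaler_sumr -big_split/=.
by apply: eq_big_nat => i ib; rewrite mH.
Qed.

Let take_lt b s t u : (size s < b)%N ->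
  take b (s ++ u :: t) = s ++ u :: take (b - (size s).+1) t.
Proof.
move=> sb; rewrite take_cat ltnNge (ltnW sb)/=.
by have -> : (b - size s = (b - (size s).+1).+1)%N by lia.
Qed.

Let drop_lt b s t u : (size s < b)%N ->
  drop b (s ++ u :: t) = drop (b - (size s).+1) t.
Proof.
move=> sb; rewrite drop_cat ltnNge (ltnW sb)/=.
by have -> : (b - size s = (b - (size s).+1).+1)%N by lia.
Qed.

Let take_ge b s t u : (b <= size s)%N -> take b (s ++ u :: t) = take b s.
Proof. by move=> bs; rewrite takel_cat. Qed.

Let drop_ge b s t u : (b <= size s)%N ->
  drop b (s ++ u :: t) = drop b s ++ u :: t.
Proof.
rewrite leq_eqVlt drop_cat => /orP[/eqP->|->//].
by rewrite ltnn subnn drop0 drop_size.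
Qed.

Let ml_at_nth0 : ml_at 1 (fun t => nth 0 t 0).
Proof. by case=> [|? ?] [|? ?] //=; rewrite ?addnS. Qed.

Let ml_at_comp a b c F G : ml_at (a + c).+1 F -> ml_at b G ->
  ml_at (a + b + c)
    (fun s => F (take a s ++ G (take b (drop a s)) :: drop (a + b) s)).
Proof.
move=> mF mG s t st k u v; have [as_|sa] := leqP a (size s).
  rewrite !(take_ge _ _ as_) !(drop_ge _ _ as_).
  have [bs|sb] := leqP b (size (drop a s)).
    rewrite !(take_ge _ _ bs).
    have abs : (a + b <= size s)%N.
      by move: bs as_; rewrite size_drop; lia.
    rewrite !(drop_ge _ _ abs) -!cat_cons !catA mF// size_cat/= size_drop.
    by rewrite size_takel//; lia.
  rewrite !take_lt//.
  have sab : (size s < a + b)%N by move: sb as_; rewrite size_drop; lia.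
  rewrite !drop_lt// mG; last first.
    by rewrite size_take !size_drop; case: ifP; lia.
  by rewrite mF// size_takel// size_drop; lia.
rewrite !take_lt// !drop_lt; [|lia..].
rewrite -!catA/= mF// size_cat/= !size_drop size_takel; lia.
Qed.

Variable mul : {bilinear A -> A -> A}.

Let ml_at_mul b c F G : ml_at b F -> ml_at c G ->
  ml_at (b + c) (fun s => mul (F (take b s)) (G (drop b s))).
Proof.
move=> mF mG s t st k u v; have [bs|sb] := leqP b (size s).
  rewrite !take_ge// !drop_ge// mG ?linearPr// size_drop; lia.
rewrite !take_lt// !drop_lt// mF ?linearPl// size_takel; lia.
Qed.

Let segment1 s j : segment s 1 j = take j s.
Proof. by rewrite /segment drop0. Qed.

Let segment_end s i N : size s = N -> segment s i.+1 N = drop i s.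
Proof. by move=> <-; rewrite /segment take_size. Qed.

Let ml_at_l (m n i : nat) f g : multilinear f -> multilinear g -> (i < m)%N ->
  ml_at (m + n) (fun s => f (segment s 1 (i.+1 - 1) ++
     mul (entry s i.+1) (g (segment s i.+2 (i.+1 + n)))
       :: segment s (i.+1 + n).+1 (m + n))).
Proof.
move=> mf mg im; pose H s := mul (nth 0 (take 1 s) 0) (g (drop 1 s)).
have mH : ml_at (1 + n) H 
  by apply: (@ml_at_mul 1 n (fun t => nth 0 t 0) g) => //; exact: ml_atW.
have := @ml_at_comp i (1 + n) (m - i.+1) f H (ml_atW mf) mH.
have -> : (i + (1 + n) + (m - i.+1) = m + n)%N by lia.
apply: eq_ml_at => s ss; rewrite segment1 subSS subn0 (segment_end _ ss).
rewrite addSnnS; congr (f (_ ++ mul _ (g _) :: _)).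
  by rewrite /entry nth_take// nth_take// nth_drop addn0.
  by rewrite /segment /= take_drop drop_drop; congr (drop _ (take _ s)); lia.
by congr (drop _ s); lia.
Qed.

Let ml_at_r (m n i : nat) f g : multilinear f -> multilinear g -> (i < m)%N ->
  ml_at (m + n) (fun s => f (segment s 1 (i.+1 - 1) ++
     mul (g (segment s i.+1 (i.+1 + n - 1))) (entry s (i.+1 + n))
       :: segment s (i.+1 + n).+1 (m + n))).
Proof.
move=> mf mg im; pose H s := mul (g (take n s)) (nth 0 (drop n s) 0).
have mH : ml_at (n + 1) H.
  by apply: (@ml_at_mul n 1 g (fun t => nth 0 t 0)) => //; exact: ml_atW.
have := @ml_at_comp i (n + 1) (m - i.+1) f H (ml_atW mf) mH.
have -> : (i + (n + 1) + (m - i.+1) = m + n)%N by lia.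
apply: eq_ml_at => s ss; rewrite segment1 subSS subn0 (segment_end _ ss).
congr (f (_ ++ mul (g _) _ :: _)).
- rewrite take_takel ?leq_addr// take_drop /segment /=.
  by congr (drop _ (take _ s)); lia.
- rewrite /entry nth_drop addn0 nth_take ?addn1// nth_drop.
  by congr (nth _ s _); lia.
by congr (drop _ s); lia.
Qed.

Lemma l2_formula_linear m n f g : multilinear f -> multilinear g ->
  forall s t, (size s + (size t).+1 = m + n)%N ->
  linear (fun u => l2_formula mul m n f g (s ++ u :: t)).
Proof.
move=> mf mg; rewrite -/(ml_at (m + n) (l2_formula mul m n f g)).
have ml2 (a b : nat) F G : multilinear F -> multilinear G -> (a + b = m + n)%N ->
    ml_at (m + n) (fun s => mul (F (segment s 1 a)) (G (segment s a.+1 (m + n)))).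
  move=> mF mG <-; have := ml_at_mul (@ml_atW a _ mF) (@ml_atW b _ mG).
  by apply: eq_ml_at => s ss; rewrite segment1 segment_end.
rewrite /l2_formula; do ![apply: ml_atD | apply: ml_atN | apply: ml_atZ].
- by apply: (ml2 n m g f) => //; exact: addnC.
- exact: (ml2 m n f g mf mg erefl).
all: apply: ml_at_sum => -[//|i] /andP[_]; rewrite ltnS => im; apply: ml_atZ.
- exact: (ml_at_l mf mg im).
- exact: (ml_at_r mf mg im).
- by rewrite addnC; exact: (ml_at_r mg mf im).
- by rewrite addnC; exact: (ml_at_l mg mf im).
Qed.

Let size_segment s i j : (j <= size s)%N -> size (segment s i j) = (j - i.-1)%N.
Proof. by move=> js; rewrite size_drop size_takel. Qed.

Lemma eq_l2_formula m n f f' g g' s : size s = (m + n)%N ->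
  (forall t, size t = m -> f t = f' t) -> (forall t, size t = n -> g t = g' t) ->
  l2_formula mul m n f g s = l2_formula mul m n f' g' s.
Proof.
move=> ss ff' gg'; rewrite /l2_formula.
have ssz : (m + n <= size s)%N by rewrite ss.
congr (_ *: mul _ _ + _ *: mul _ _ - _ + _ - _ + _).
all: rewrite ?(ff', gg') ?size_segment//; try lia.
all: apply: eq_big_nat => i /andP[i0 im]; congr (_ *: _).
all: rewrite ?(ff', gg') ?size_cat/= ?size_segment//; try lia.
Qed.

Let ml0 F s t : multilinear F -> F (s ++ 0 :: t) = 0.
Proof.
move=> mF; have := mF s t 1 0 0; rewrite scaler0 addr0 scale1r => /eqP.
by rewrite -subr_eq subrr eq_sym => /eqP.
Qed.

Lemma l2_formula0l m n g s : multilinear g -> l2_formula mul m n (fun=> 0) g s = 0.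
Proof.
move=> mg; rewrite /l2_formula !linear0l !linear0r !scaler0.
rewrite !big1 ?subr0 ?addr0// => i _; rewrite ?scaler0//.
  by rewrite linear0r ml0// scaler0.
by rewrite linear0l ml0// scaler0.
Qed.

Lemma l2_formula0r m n f s : multilinear f -> l2_formula mul m n f (fun=> 0) s = 0.
Proof.
move=> mf; rewrite /l2_formula !linear0l !linear0r !scaler0.
rewrite !big1 ?subr0 ?addr0// => i _; rewrite ?scaler0//.
  by rewrite linear0l ml0// scaler0.
by rewrite linear0r ml0// scaler0.
Qed.

Lemma l2_is_cochain (F G : cochain A) : is_cochain (l2_fun mul F G).
Proof.
have [mF F0 [N FN]] := cochainP F; have [mG G0 [M GM]] := cochainP G.
split=> [s t||].
- have mFG : ml_at (size s + (size t).+1) (l2_fun mul F G).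
    rewrite /l2_fun; apply: eq_ml_at (ml_at_sum (H := fun m =>
      l2_formula mul m (size s + (size t).+1 - m) F G) _).
      by move=> r ->.
    move=> m /andP[m0 mb] r q rq; apply: l2_formula_linear => //.
    by rewrite rq; lia.
  exact: mFG.
- by rewrite /l2_fun big_geq.
exists (N + M)%N => s sNM; rewrite /l2_fun big_nat big1// => m /andP[m0 ms].
have ss : size s = (m + (size s - m))%N by lia.
have [Nm|mN] := ltnP N m.
  rewrite (eq_l2_formula (f' := fun=> 0) (g' := G) ss) ?l2_formula0l//.
  by move=> t tm; apply: FN; rewrite tm.
rewrite (eq_l2_formula (f' := F) (g' := fun=> 0) ss) ?l2_formula0r//.
by move=> t tm; apply: GM; rewrite tm; lia.
Qed.

Definition l2 (F G : cochain A) : cochain A := mk_cochain (l2_is_cochain F G).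

Lemma l2_homE (m n : nat) (F G : cochain A) (s : seq A) :
  cochain_degree m F -> cochain_degree n G ->
  l2 F G s = if size s == (m.+1 + n.+1)%N
             then l2_formula mul m.+1 n.+1 F G s else 0.
Proof.
move=> dF dG; have [mF _ _] := cochainP F; have [mG _ _] := cochainP G.
have l20 k : (0 < k < size s)%N -> (k != m.+1) || (size s - k != n.+1)%N ->
    l2_formula mul k (size s - k) F G s = 0.
  move=> ks; have ss : size s = (k + (size s - k))%N by lia.
  case/orP=> [km|kn].
    rewrite (eq_l2_formula (f' := fun=> 0) (g' := G) ss) ?l2_formula0l//.
    by move=> t tk; apply: dF; move: km; rewrite tk; lia.
  rewrite (eq_l2_formula (f' := F) (g' := fun=> 0) ss) ?l2_formula0r//.
  by move=> t tk; apply: dG; move: kn; rewrite tk; lia.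
rewrite [LHS]/(l2_fun mul F G s) /l2_fun; case: eqP => [ss|ss].
  rewrite (bigD1_seq m.+1) ?iota_uniq ?mem_index_iota//=; last by lia.
  rewrite big_seq_cond big1 ?addr0; last first.
    move=> k; rewrite mem_index_iota => /andP[k0 km].
    by apply: l20 => //; rewrite km.
  by rewrite {1}ss addKn.
rewrite big_nat big1// => k k0; apply: l20 => //; lia.
Qed.

Lemma l0_is_cochain (lambda : K) :
  is_cochain (fun s : seq A => if s is [:: x; y] then lambda *: mul x y else 0).
Proof.
split=> [s t k u v||]; first last.
- by exists 2%N => -[|? [|? [|]]].
- by [].
case: s => [|x [|y [|z s]]]/=; rewrite ?scaler0 ?addr0//; last first.
- by case: t => [|? ?]; rewrite ?scaler0 ?addr0// linearPr scalerDr !scalerA mulrC.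
case: t => [|y [|? ?]]; rewrite ?scaler0 ?addr0//.
by rewrite linearPl scalerDr !scalerA mulrC.
Qed.

Definition l0 (lambda : K) : cochain A := mk_cochain (l0_is_cochain lambda).

Definition mrb_brackets (lambda : K) (xs : seq (cochain A)) : cochain A :=
  match xs with
  | [::] => l0 lambda
  | [:: F; G] => l2 F G
  | _ => 0
  end.

End BracketIsCochain.

Lemma cochain1_is_cochain (K : fieldType) (A : lmodType K)
    (D : {linear A -> A}) :
  is_cochain (fun s : seq A => if s is [:: x] then D x else 0).
Proof.
split=> [s t k u v||]; first last.
- by exists 1%N => -[|? []].
- by [].
case: s => [|x [|y s]]/=; rewrite ?scaler0 ?addr0//.
by case: t => [|? ?]; rewrite ?scaler0 ?addr0// linearP.
Qed.

(* A linear map, as an element of Hom(A, A) in the direct sum.                *)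
Definition cochain1 (K : fieldType) (A : lmodType K) (D : {linear A -> A}) :
  cochain A := mk_cochain (cochain1_is_cochain D).

Definition modified_rota_baxter (K : fieldType) (A : lmodType K)
    (mul : A -> A -> A) (lambda : K) (D : A -> A) : Prop :=
  forall x y : A,
    mul (D x) (D y) - D (mul x (D y)) - D (mul (D x) y) = - (lambda *: mul x y).

(* Main.v *)
Require Import Defs.
From HB Require Import structures.
From mathcomp Require Import all_boot all_order all_algebra all_fingroup.
From mathcomp Require Import boolp functions zify.

Set Implicit Arguments.
Unset Strict Implicit.
Unset Printing Implicit Defensive.

Import GRing.Theory.
Local Open Scope ring_scope.

(** A cochain f of arity m has degree m - 1.  Put
    lie m n f g = (-1)^(m(n-1)) l2(f, g), where n is the arity of g.  This
    change of sign turns degrees m - 1 into degrees m and symmetry into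
    antisymmetry, and the theorem becomes: [lie] is a graded Lie bracket, for
    which l0 is central.

    The bracket [lie] comes from a graded post-Lie structure.  The cup product
    of f and g multiplies the values of f and g on consecutive blocks of
    arguments; it is associative, so its graded commutator [f, g] ([brk]) is a
    Lie bracket.  Let id be the identity of A, a cochain of arity 1.  Inserting
    a fixed cochain h, with signs, into each argument of a variable cochain is
    a graded derivation of the cup product which sends id to h ([ins_cup],
    [ins_idc]); write f |> _ for the insertion of - [f, id] ([act]).  Sorting
    the six sums of the formula for l2 gives ([l2_formulaE])

      lie f g = f |> g - (-1)^(mn) g |> f + [f, g].

    The Jacobi identity for such a bracket ([lie_jacobi]) follows formally from
    two facts: each f |> _ is a derivation of [ , ], and f |> _ is a
    representation, (lie f g) |> _ = the graded commutator of f |> _ and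
    g |> _ ([act_lie]).  The second holds because a graded commutator of
    insertions is again an insertion (the pre-Lie identity [ins_preLie]),
    namely that of its value on id; comparing the values on id is the Jacobi
    identity for [ , ] applied to f, g and id.

    Next, l0 = lambda (id cup id).  By associativity [id cup id, id] = 0, so
    l0 acts by zero; and g |> _, being a derivation with id |-> - [g, id],
    sends id cup id to [id cup id, g], which cancels the last term of
    lie l0 g.  Hence l2(l0, g) = 0 ([l2_l0]).

    As only l0 and l2 are nonzero, the n-th structure relation is nontrivial
    only for n = 1, where it reads l2(l0, g) = 0, and for n = 3, where the
    three (2,1)-shuffles give the Jacobi identity.  Finally a cochain of degree
    0 is a linear map D, and l0 + l2(D, D) / 2 sends (x, y) to
    lambda x y + D(x) D(y) - D(x D(y)) - D(D(x) y), whose vanishing is the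
    modified Rota-Baxter equation. *)

(** * Deciding identities in abelian groups *)

(** The identities below are, once signs are resolved by parity, equalities
    between sums of up to about forty signed terms.  They are decided by
    reflection: two expressions are equal as soon as every atom has the same
    integer coefficient in both. *)
Inductive zterm :=
  ZAtom of nat | ZZero | ZAdd of zterm & zterm | ZOpp of zterm.

Fixpoint zeval (V : zmodType) (env : seq V) (t : zterm) : V :=
  match t with
  | ZAtom i => env`_i
  | ZZero => 0
  | ZAdd t u => zeval env t + zeval env u
  | ZOpp t => - zeval env t
  end.

Fixpoint zcoef (t : zterm) (i : nat) : int :=
  match t with
  | ZAtom j => (i == j)%:Z
  | ZZero => 0
  | ZAdd t u => zcoef t i + zcoef u i
  | ZOpp t => - zcoef t i
  end.

Lemma zevalE (V : zmodType) (env : seq V) t :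
  zeval env t = \sum_(i < size env) env`_i *~ zcoef t i.
Proof.
elim: t => [j||t IHt u IHu|t IHt] /=.
- have [jn|nj] := ltnP j (size env).
    rewrite (bigD1 (Ordinal jn))//= eqxx mulr1z big1 ?addr0// => i ij.
    by rewrite -[(i == j :> nat)]/(i == Ordinal jn) (negPf ij) mulr0z.
  rewrite nth_default// big1// => i _.
  by rewrite ltn_eqF ?mulr0z// (leq_trans (ltn_ord i)).
- by rewrite big1// => i _; rewrite mulr0z.
- by rewrite IHt IHu -big_split; apply: eq_bigr => i _; rewrite mulrzDr.
- by rewrite IHt -sumrN; apply: eq_bigr => i _; rewrite mulrNz.
Qed.

Lemma zeval_eq (V : zmodType) (env : seq V) t u :
  all (fun i => zcoef t i == zcoef u i) (iota 0 (size env)) ->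
  zeval env t = zeval env u.
Proof.
move=> /allP tu; rewrite !zevalE; apply: eq_bigr => i _.
by rewrite (eqP (tu _ _))// mem_iota ltn_ord.
Qed.

(* Atoms are compared up to unification, because the same vector may carry
   different presentations of its module structure. *)
Ltac zindex x env :=
  match env with
  | ?y :: _ => let _ := match constr:(tt) with _ => unify x y end in constr:(O)
  | _ :: ?env' => let i := zindex x env' in constr:(S i)
  end.
Ltac zinsert x env :=
  match env with
  | _ => let i := zindex x env in constr:(env)
  | _ => constr:(x :: env)
  end.
Ltac zatoms e env :=
  lazymatch e with
  | @GRing.zero _ => constr:(env)
  | @GRing.add _ ?a ?b => let env' := zatoms a env in zatoms b env'
  | @GRing.opp _ ?a => zatoms a env
  | _ => zinsert e env
  end.
Ltac zreify e env :=
  lazymatch e with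
  | @GRing.zero _ => constr:(ZZero)
  | @GRing.add _ ?a ?b =>
    let t := zreify a env in let u := zreify b env in constr:(ZAdd t u)
  | @GRing.opp _ ?a => let t := zreify a env in constr:(ZOpp t)
  | _ => let i := zindex e env in constr:(ZAtom i)
  end.
Ltac zmod :=
  lazymatch goal with
  | |- @eq ?T ?a ?b =>
    let env := zatoms a (@nil T) in let env := zatoms b env in
    let t := zreify a env in let u := zreify b env in
    apply: (@zeval_eq _ env t u); vm_compute; reflexivity
  end.

(** * Insertion of a cochain into another one *)

Section Cochains.
Variables (K : fieldType) (A : lmodType K).

Section Insertion.
Variable W : lmodType K.
Implicit Types (h : seq A -> A) (f : seq A -> W) (s : seq A).

(** The insertion of h, of arity p + 1, into f: the right action of the graded
    pre-Lie product of Gerstenhaber.  The values of f lie in an arbitrary module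
    W, and f is any function on sequences, so that one can fix the first
    argument of f and argue by induction on the sequence of arguments. *)
Definition ins p h f s : W := \sum_(i < size s - p) (-1) ^+ (i * p) *:
  f (take i s ++ h (take p.+1 (drop i s)) :: drop (i + p.+1) s).

Lemma ins_short p h f s : (size s <= p)%N -> ins p h f s = 0.
Proof. by rewrite /ins -subn_eq0 => /eqP ->; rewrite big_ord0. Qed.

Lemma ins_cons p h f x s : ins p h f (x :: s) =
  (if (p <= size s)%N then f (h (x :: take p s) :: drop p s) else 0)
  + (-1) ^+ p *: ins p h (fun t => f (x :: t)) s.
Proof.
rewrite /ins /=; case: leqP => [ps|sp].
  rewrite subSn// big_ord_recl/= mul0n expr0 scale1r; congr (_ + _).
  rewrite scaler_sumr; apply: eq_bigr => i _.
  by rewrite scalerA -exprD /bump/= mulSn.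
have [-> ->] : ((size s).+1 - p = 0 /\ size s - p = 0)%N by lia.
by rewrite !big_ord0 scaler0 addr0.
Qed.

(** An insertion into a function of two consecutive blocks of arguments takes
    place in one of the two; passing the first block, of length k, costs k
    times the degree p of h.  This gives the derivation property of insertions
    and also separates the terms of an iterated insertion. *)
Lemma ins_split p h (Phi : seq A -> seq A -> W) k s :
  ins p h (fun t => Phi (take k t) (drop k t)) s =
  ins p h (Phi^~ (drop (k + p) s)) (take (k + p) s)
  + (-1) ^+ (k * p) *: ins p h (Phi (take k s)) (drop k s).
Proof.
elim: k Phi s => [|k IHk] Phi s.
  rewrite [X in _ = X + _]ins_short ?size_take; last by case: ifP; lia.
  rewrite add0r mul0n expr0 scale1r drop0 take0.
  by congr ins; apply/funext => t; rewrite take0 drop0.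
case: s => [|x s]; first by rewrite /ins !big_ord0 scaler0 addr0.
rewrite addSn /= !ins_cons (IHk (fun u v => Phi (x :: u) v)) /=.
rewrite scalerDr scalerA -exprD -mulSn addrA; congr (_ + _ + _).
rewrite size_take; have -> : (p <= (if (k + p < size s) then k + p else size s)
  = (p <= size s))%N by case: ifP; lia.
case: leqP => // ps.
by rewrite take_takel ?leq_addl// take_drop drop_drop (addnC k p).
Qed.

Lemma ins_is_linear p h : linear (ins p h).
Proof.
move=> a f g; apply/funext => s.
rewrite -[RHS]/(a *: ins p h f s + ins p h g s) /ins scaler_sumr -big_split.
apply: eq_bigr => i _ /=.
by rewrite -[(a *: f + g) _]/(a *: f _ + g _) scalerDr !scalerA mulrC.
Qed.

HB.instance Definition _ p h :=
  GRing.isLinear.Build K (seq A -> W) (seq A -> W) *:%R (ins p h)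
    (ins_is_linear p h).

Lemma ins_linearl p a h h' f : multilinear f ->
  ins p (a *: h + h') f = a *: ins p h f + ins p h' f.
Proof.
move=> mf; apply/funext => s.
rewrite -[RHS]/(a *: ins p h f s + ins p h' f s) /ins scaler_sumr -big_split.
apply: eq_bigr => i _ /=.
by rewrite -[(a *: h + h') _]/(a *: h _ + h' _) mf scalerDr !scalerA mulrC.
Qed.

Lemma ins0l p f : multilinear f -> ins p 0 f = 0.
Proof.
move=> mf; have := ins_linearl p (-1) 0 0 mf.
by rewrite scaler0 addr0 scaleN1r addNr.
Qed.

Lemma insNl p h f : multilinear f -> ins p (- h) f = - ins p h f.
Proof.
move=> mf; have := ins_linearl p (-1) h 0 mf.
by rewrite ins0l// !scaleN1r !addr0.
Qed.
End Insertion.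

Lemma ins_linear_comp (W W' : lmodType K) (L : W -> W') p h f s : linear L ->
  ins p h (fun t => L (f t)) s = L (ins p h f s).
Proof.
move=> linL; pose L' : {linear W -> W'} :=
  HB.pack L (GRing.isLinear.Build K W W' *:%R L linL).
rewrite -[L]/(L' : W -> W') /ins linear_sum.
by apply: eq_bigr => i _; rewrite linearZ.
Qed.

(** In [ins p a (ins q b f)] either a lands inside b, which gives the insertion
    of [ins p a b], or a and b occupy disjoint places of f.  The second kind of
    terms is graded symmetric in a and b, whence the identity. *)
Lemma ins_preLie (W : lmodType K) p q a b (f : seq A -> W) : multilinear f ->
  ins p a (ins q b f) - ins (p + q) (ins p a b) f =
  (-1) ^+ (p * q) *: (ins q b (ins p a f) - ins (p + q) (ins q b a) f).
Proof.
(* T collects the terms in which a takes the first argument x and b occurs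
   further right, U all the terms with a and b at disjoint places. *)
pose T p q a b (f : seq A -> W) s x :=
  if (p <= size s)%N
  then ins q b (fun t => f (a (x :: take p s) :: t)) (drop p s) else 0.
pose U p q a b (f : seq A -> W) s :=
  ins p a (ins q b f) s - ins (p + q) (ins p a b) f s.
(* If one of a, b takes x, the other one is inserted in the remaining
   arguments; otherwise both are inserted in f with first argument x. *)
have U_cons p' q' a' b' f' s x : multilinear f' ->
    U p' q' a' b' f' (x :: s) = (-1) ^+ q' *: T p' q' a' b' f' s x
     + (-1) ^+ (p' + p' * q') *: T q' p' b' a' f' s x
     + (-1) ^+ (p' + q') *: U p' q' a' b' (fun t => f' (x :: t)) s.
  clear p q a b f; move: p' q' a' b' f' => p q a b f mf; rewrite /U.
  (* The inner insertion at x leaves a function of two blocks: the arguments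
     u that b takes besides x, and the rest v. *)
  pose Phi u v := if (q <= size u)%N then f (b (x :: u) :: v) else 0.
  have b_cons : (fun t => ins q b f (x :: t)) =
      (fun t => Phi (take q t) (drop q t))
      + (-1) ^+ q *: ins q b (fun t => f (x :: t)).
    apply/funext => t.
    by rewrite ins_cons fctE/= /Phi size_take_min leq_min leqnn.
  rewrite ins_cons b_cons linearD linearZ/= !fctE/= ins_split.
  rewrite [X in _ - X]ins_cons.
  have -> : ins p a (Phi (take q s)) (drop q s) = T q p b a f s x.
    rewrite /T /Phi size_take_min leq_min leqnn /=.
    by case: leqP => // _; rewrite [LHS]big1// => i _; rewrite scaler0.
  have -> : ins p a (Phi^~ (drop (q + p) s)) (take (q + p) s) =
      if (p + q <= size s)%N then
        f (ins p a (fun t => b (x :: t)) (take (p + q) s) :: drop (p + q) s)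
      else 0.
    rewrite (addnC q p) -(ins_linear_comp _ _ _ _ (mf [::] _)) /=.
    case: leqP => pqs.
      apply: eq_bigr => -[i/= iP] _; congr (_ *: _); rewrite /Phi ifT//.
      by move: iP; rewrite size_cat/= size_drop !size_take_min; lia.
    rewrite [LHS]big1// => -[i/= iP] _; rewrite /Phi ifF ?scaler0//.
    by move: iP; rewrite size_cat/= size_drop !size_take_min; lia.
  have -> : (if (p + q <= size s)%N
      then f (ins p a b (x :: take (p + q) s) :: drop (p + q) s) else 0) =
      (if (p + q <= size s)%N then
        f (b (a (x :: take p s) :: take q (drop p s)) :: drop (p + q) s) else 0)
      + (-1) ^+ p *: if (p + q <= size s)%N then
        f (ins p a (fun t => b (x :: t)) (take (p + q) s) :: drop (p + q) s)
        else 0.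
    case: leqP => pqs; last by rewrite scaler0 addr0.
    rewrite ins_cons size_takel// leq_addr take_takel ?leq_addr//.
    by rewrite take_drop (addnC q) addrC (mf [::]) addrC.
  have -> : (if (p <= size s)%N then ins q b f (a (x :: take p s) :: drop p s)
       else 0) = (if (p + q <= size s)%N then
        f (b (a (x :: take p s) :: take q (drop p s)) :: drop (p + q) s) else 0)
      + (-1) ^+ q *: T p q a b f s x.
    rewrite /T; case: leqP => [ps|sp]; last first.
      by rewrite ifF ?scaler0 ?addr0//; lia.
    by rewrite ins_cons size_drop leq_subRL// drop_drop (addnC q).
  rewrite !scalerDr !scalerA -!exprD scalerN (mulnC q p); zmod.
move=> mf; apply/funext => s; rewrite -[LHS]/(U p q a b f s).
rewrite (addnC p q) -[RHS]/(_ *: U q p b a f s).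
elim: s f mf => [|x s IHs] f mf.
  by rewrite /U /ins !big_ord0 subrr scaler0.
rewrite !U_cons// IHs; last by move=> u v; apply: (mf (x :: u) v).
rewrite !scalerDr !scalerA -!exprD (mulnC q p) (addnC q p).
congr (_ + _); last by rewrite addnC.
rewrite addrC; congr (_ + _); congr (_ *: _); first by rewrite addnC.
by rewrite addnCA addnn exprD -mul2n exprM sqrrN !expr1n mulr1.
Qed.

(** * The cup product and the graded Lie bracket *)

Variable mul : {bilinear A -> A -> A}.
Hypothesis mulA : associative mul.
Implicit Types (f g h : seq A -> A) (F G H : cochain A).

Definition cup m f g : seq A -> A := fun s => mul (f (take m s)) (g (drop m s)).

Lemma cupDl m f g h : cup m (f + g) h = cup m f h + cup m g h.
Proof. by apply/funext => s; rewrite /cup !fctE linearDl. Qed.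
Lemma cupDr m f g h : cup m h (f + g) = cup m h f + cup m h g.
Proof. by apply/funext => s; rewrite /cup !fctE linearDr. Qed.
Lemma cupNl m f h : cup m (- f) h = - cup m f h.
Proof. by apply/funext => s; rewrite /cup !fctE linearNl. Qed.
Lemma cupNr m f h : cup m h (- f) = - cup m h f.
Proof. by apply/funext => s; rewrite /cup !fctE linearNr. Qed.
Lemma cupZl m a f h : cup m (a *: f) h = a *: cup m f h.
Proof. by apply/funext => s; rewrite /cup !fctE linearZl_LR. Qed.
Lemma cupZr m a f h : cup m h (a *: f) = a *: cup m h f.
Proof. by apply/funext => s; rewrite /cup !fctE linearZr_LR. Qed.
Definition cup_lin := (cupDl, cupDr, cupNl, cupNr, cupZl, cupZr).

Lemma cupA m n f g h : cup (m + n) (cup m f g) h = cup m f (cup n g h).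
Proof.
apply/funext => s; rewrite /cup take_takel ?leq_addr// mulA.
by rewrite take_drop drop_drop !(addnC n).
Qed.

(** The same identity for the other order of the sum of arities, which is the
    one that results from rewriting with [ins_cup]. *)
Lemma cupA_sym m n f g h : cup (n + m) (cup m f g) h = cup m f (cup n g h).
Proof. by rewrite addnC cupA. Qed.

(** The derivation property: h is inserted either on the left of the cup
    product or, past the m arguments of f, on its right. *)
Lemma ins_cup p a m f g : ins p a (cup m f g) =
  cup (m + p) (ins p a f) g + (-1) ^+ (m * p) *: cup m f (ins p a g).
Proof.
apply/funext => s; rewrite !fctE /cup.
rewrite (ins_split _ _ (fun u v => mul (f u) (g v))); congr (_ + _ *: _).
  by rewrite (ins_linear_comp (L := mul^~ _)) // => c x y; rewrite linearPl.
by rewrite (ins_linear_comp (L := mul _)) // => c x y; rewrite linearPr.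
Qed.

(** The graded commutator for the cup product, where arity is the degree. *)
Definition brk m n f g : seq A -> A := cup m f g - (-1) ^+ (m * n) *: cup n g f.

(** The identity of A; being zero in other arities than 1 makes it a cochain. *)
Definition idc (s : seq A) : A := if s is [:: x] then x else 0.

(** The derivation f |> _ of the cup product.  Its value - [f, id] on id is
    the one for which the sum of f |> _ and of the inner derivation [f, _]
    kills id. *)
Definition act m f g : seq A -> A := ins m (- brk m 1 f idc) g.

Definition lie m n f g : seq A -> A :=
  act m f g - (-1) ^+ (m * n) *: act n g f + brk m n f g.

Definition supported (m : nat) f := forall s, size s != m -> f s = 0.

Lemma idc_supported : supported 1 idc.
Proof. by case=> [|? []]. Qed.

(** There is a single place for an insertion into a cochain of arity 1, so an
    insertion can be recovered from its value on id. *)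
Lemma ins_idc p a : supported p.+1 a -> ins p a idc = a.
Proof.
move=> sa; apply/funext => s; have [sp|sp] := eqVneq (size s) p.+1.
  rewrite /ins sp subSnn big_ord1 mul0n expr0 scale1r take0 drop0 /=.
  by rewrite add0n -sp take_size drop_size.
rewrite sa// [LHS]big1// => -[i/= iP] _; rewrite idc_supported ?scaler0//.
rewrite size_cat/= size_drop size_take_min; lia.
Qed.

Lemma cup_supported m n f g :
  supported m f -> supported n g -> supported (m + n) (cup m f g).
Proof.
move=> mf ng s ss; rewrite /cup; have [sm|sm] := eqVneq (size (take m s)) m.
  rewrite [g _]ng ?linear0r// size_drop.
  by move: ss sm; rewrite size_take_min; lia.
by rewrite mf// linear0l.
Qed.

Lemma brk_idc_supported m f : supported m f -> supported m.+1 (brk m 1 f idc).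
Proof.
move=> sf s ss; rewrite /brk !fctE.
rewrite (cup_supported sf idc_supported) ?addn1//.
by rewrite (cup_supported idc_supported sf) ?scaler0 ?subrr.
Qed.

(** Moves a sign from the scalars to the group structure, where it can be
    resolved by a case analysis on parities. *)
Lemma signZE (V : lmodType K) n (v : V) :
  (-1) ^+ n *: v = if odd n then - v else v.
Proof. by rewrite -signr_odd; case: odd; rewrite ?scaleN1r ?scale1r. Qed.

Lemma act_cup p a m f g : act p a (cup m f g) =
  cup (m + p) (act p a f) g + (-1) ^+ (m * p) *: cup m f (act p a g).
Proof. exact: ins_cup. Qed.

Lemma actD m f g h : act m f (g + h) = act m f g + act m f h.
Proof. exact: linearD. Qed.
Lemma actN m f g : act m f (- g) = - act m f g.
Proof. exact: linearN. Qed.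
Lemma actZ m f a g : act m f (a *: g) = a *: act m f g.
Proof. by rewrite /act linearZ. Qed.

(** The action is a representation of the bracket [lie].  Both sides are
    insertions in h, by the pre-Lie identity on the right, so it is enough to
    compare the inserted cochains; this is the Jacobi identity of the graded
    commutator for f, g and id, that is, associativity of the cup product. *)
Lemma act_lie m n f g h :
  supported m f -> supported n g -> multilinear h ->
  act (m + n) (lie m n f g) h =
  act m f (act n g h) - (-1) ^+ (m * n) *: act n g (act m f h).
Proof.
move=> sf sg mh; pose a := - brk m 1 f idc; pose b := - brk n 1 g idc.
have aU : act m f idc = a.
  by apply: ins_idc => s ss; rewrite fctE brk_idc_supported ?oppr0.
have bU : act n g idc = b.
  by apply: ins_idc => s ss; rewrite fctE brk_idc_supported ?oppr0.
have /(canRL (subrK _)) : ins m a (ins n b h) - ins (m + n) (ins m a b) h = _ :=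
  ins_preLie m n a b mh.
rewrite -![ins _ a _]/(act m f _) -![ins _ b _]/(act n g _) => ->.
rewrite scalerBr addrAC -addrA addrACA subrr add0r -scaleNr -ins_linearl//.
rewrite [LHS]/act; congr (ins _ _ h); rewrite scaleNr /a /b /brk.
rewrite !(actD, actN, actZ, act_cup) aU bU /a /b /lie /brk !cup_lin.
rewrite !(addnC 1%N) !(cupA, cupA_sym) (addnC n m) !signZE !(oddD, oddM).
by case: (odd m); case: (odd n); rewrite /=; zmod.
Qed.

(** The Jacobi identity in Leibniz form.  After [act_lie] and the derivation
    property, the terms are of three kinds: f |> (g |> h), cup products such as
    (f |> g) cup h, and triple cup products.  Each kind cancels by itself, for
    every choice of the parities of m, n and p. *)
Lemma lie_jacobi m n p f g h :
  supported m f -> supported n g -> supported p h ->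
  multilinear f -> multilinear g -> multilinear h ->
  lie (m + n) p (lie m n f g) h = lie m (n + p) f (lie n p g h)
    - (-1) ^+ (m * n) *: lie n (m + p) g (lie m p f h).
Proof.
move=> sf sg sh mf mg mh.
rewrite {1}/lie act_lie// [lie m (n + p) _ _]/lie act_lie//.
rewrite [lie n (m + p) _ _]/lie act_lie//.
rewrite /lie /brk !(actD, actN, actZ, act_cup).
rewrite !cup_lin.
rewrite (addnC p m) (addnC p n) (addnC n m).
rewrite !(cupA, cupA_sym).
rewrite !signZE !(oddD, oddM).
by case: (odd m); case: (odd n); case: (odd p); rewrite /=; zmod.
Qed.

(** * The bracket l2 in terms of the graded Lie bracket *)

Lemma idc_take1 s : idc (take 1 s) = nth 0 s 0.
Proof. by case: s => [|x s]//=; rewrite take0. Qed.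

(** The shape in which the bracket formula contains an insertion of
    [f, id](y_0, ..., y_m) = f(y_0, ...) y_m - (-1)^m y_0 f(y_1, ...): one sum
    for each of the two products. *)
Lemma ins_brk_idc m n f g s : multilinear g -> size s = (m + n)%N ->
  ins m (brk m 1 f idc) g s =
  \sum_(1 <= i < n.+1) (-1) ^+ ((i - 1) * m) *:
    g (segment s 1 (i - 1) ++
       mul (f (segment s i (i + m - 1))) (entry s (i + m))
         :: segment s (i + m).+1 (m + n))
  - (-1) ^+ m *: \sum_(1 <= i < n.+1) (-1) ^+ ((i - 1) * m) *:
    g (segment s 1 (i - 1) ++
       mul (entry s i) (f (segment s i.+1 (i + m)))
         :: segment s (i + m).+1 (m + n)).
Proof.
move=> mg ss; rewrite !big_add1/= !big_mkord.
rewrite scaler_sumr -sumrB /ins ss addKn; apply: eq_bigr => i _.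
rewrite subn1/= scalerA mulrC -scalerA -scalerBr; congr (_ *: _).
rewrite /segment/= drop0 -ss take_size addSnnS.
have -> : brk m 1 f idc (take m.+1 (drop i s)) =
   - (-1) ^+ m *: mul (entry s i.+1) (f (drop i.+1 (take (i + m.+1) s)))
   + mul (f (drop i (take (i + m.+1 - 1) s))) (entry s (i + m.+1)).
  have im := ltn_ord i.
  rewrite /brk !fctE /cup muln1 take_takel ?leqnSn// scaleNr addrC.
  congr (_ + _); last first.
    rewrite -(add1n m) -take_drop idc_take1 drop_drop nth_drop addn0.
    by rewrite take_drop /entry addnS subn1 (addnC m).
  rewrite -(addn1 m) take_takel ?addn1// idc_take1 -(addn1 m) -take_drop.
  by rewrite drop_drop nth_drop addn0 take_drop add1n addnCA addn1.
by rewrite mg scaleNr addrC.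
Qed.

(** The change of sign that relates l2 and the Lie bracket: in the formula the
    cup products form [f, g], the two sums over the arguments of f form g |> f,
    and the two others form f |> g. *)
Lemma l2_formulaE m n f g s : (0 < m)%N -> (0 < n)%N ->
  multilinear f -> multilinear g -> size s = (m + n)%N ->
  l2_formula mul m n f g s = (-1) ^+ (m * (n - 1)) *: lie m n f g s.
Proof.
move=> m0 n0 mf mg ss; have ss' : size s = (n + m)%N by rewrite addnC.
have pull (e : K) k (c : nat -> K) (X : nat -> A) :
  \sum_(1 <= i < k) (c i * e) *: X i = e *: \sum_(1 <= i < k) c i *: X i.
  by rewrite scaler_sumr; apply: eq_bigr => i _; rewrite scalerA mulrC.
(* In this sum the sign of the formula is that of inserting g one place
   further, which costs (-1)^n. *)
have shift k (X : nat -> A) : \sum_(1 <= i < k) (-1) ^+ (i * n) *: X i =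
    (-1) ^+ n *: \sum_(1 <= i < k) (-1) ^+ ((i - 1) * n) *: X i.
  rewrite scaler_sumr; apply: eq_big_nat => i /andP[i0 _].
  by rewrite scalerA -exprD -mulSn -subSn// subn1.
rewrite /lie /act /brk !fctE !insNl// !fctE /cup.
rewrite (ins_brk_idc _ mg ss) (ins_brk_idc _ mf ss').
rewrite /l2_formula !pull shift (addnC n m) /segment !drop0 /= -ss take_size.
rewrite !signZE !(oddM, oddD, oddB)//=.
by case: (odd m); case: (odd n); rewrite /= ?opprK; zmod.
Qed.

Lemma ins_supported p q h f : supported q f -> supported (q + p) (ins p h f).
Proof.
move=> sf s ss; rewrite [LHS]big1// => -[i/= iP] _; rewrite sf ?scaler0//.
rewrite size_cat/= size_drop size_take_min; lia.
Qed.

Lemma lie_supported m n f g : supported m f -> supported n g ->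
  supported (m + n) (lie m n f g).
Proof.
move=> sf sg s ss; have ss' : size s != (n + m)%N by rewrite addnC.
rewrite /lie /act /brk !fctE (ins_supported _ sf)// (ins_supported _ sg)//.
rewrite (cup_supported sf sg)// (cup_supported sg sf)//.
by rewrite !(scaler0, subr0, oppr0, addr0).
Qed.

Lemma lieC m n f g : lie m n f g = - ((-1) ^+ (m * n) *: lie n m g f).
Proof.
rewrite /lie /brk (mulnC n m) !signZE.
by case: (odd (m * n)); zmod.
Qed.

Lemma lie_linear_l m n a f f' g : multilinear g ->
  lie m n (a *: f + f') g = a *: lie m n f g + lie m n f' g.
Proof.
move=> mg.
have lin k h : multilinear h ->
   act k (a *: f + f') h = a *: act k f h + act k f' h.
  move=> mh; rewrite /act.
  have -> : - brk k 1 (a *: f + f') idc =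
    a *: - brk k 1 f idc - brk k 1 f' idc.
    rewrite /brk !cup_lin !(scalerDr, scalerN, scalerA) (mulrC a); zmod.
  by rewrite ins_linearl.
rewrite /lie lin// actD actZ /brk !cup_lin !(scalerDr, scalerN, scalerA).
rewrite !(mulrC a); zmod.
Qed.

Lemma lie_linear_r m n a f g g' : multilinear f ->
  lie m n f (a *: g + g') = a *: lie m n f g + lie m n f g'.
Proof.
move=> mf; rewrite lieC lie_linear_l// (lieC m n f g) (lieC m n f g').
by rewrite scalerDr !scalerA mulrC opprD -scalerA scalerN.
Qed.

(** Needed for f a value of l2, which is a signed value of [lie]. *)
Lemma lieZl m n a f g : multilinear g -> lie m n (a *: f) g = a *: lie m n f g.
Proof.
move=> mg; rewrite -[a](subrK 1); move: (a - 1) => b.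
by rewrite !scalerDl !scale1r lie_linear_l.
Qed.

Lemma cochain_supported m (F : cochain A) :
  cochain_degree m%:Z F -> supported m.+1 F.
Proof. by move=> dF s /eqP ss; apply: dF; lia. Qed.

Lemma cochain_multilinear (F : cochain A) : multilinear F.
Proof. by case: (cochainP F). Qed.

(** A cochain of degree -1 would have arity 0.  Thus statements for integer
    degrees reduce to natural ones. *)
Lemma cochain_degree_neg m (F : cochain A) : cochain_degree (Negz m) F -> F = 0.
Proof.
move=> dF; apply/val_inj/funext => -[|x s]; first by case: (cochainP F).
by apply: dF => /=; lia.
Qed.

Lemma l2_lie m n (F G : cochain A) :
  cochain_degree m%:Z F -> cochain_degree n%:Z G ->
  l2 mul F G = (-1) ^+ (m.+1 * n) *: lie m.+1 n.+1 F G :> (seq A -> A).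
Proof.
move=> dF dG; apply/funext => s.
rewrite (l2_homE mul s dF dG) -[RHS]/(_ *: lie m.+1 n.+1 F G s).
case: eqP => [ss|/eqP ss].
  by rewrite l2_formulaE ?subn1//; apply: cochain_multilinear.
rewrite (lie_supported (cochain_supported dF) (cochain_supported dG))//.
by rewrite scaler0.
Qed.

(** The splitting of l2 into arities in terms of [lie] makes sense for all
    cochains, homogeneous or not, and so yields bilinearity on the whole sum. *)
Lemma l2_funE (F G : cochain A) s : l2 mul F G s =
  \sum_(1 <= m < size s) (-1) ^+ (m * (size s - m - 1)) *:
     lie m (size s - m) F G s.
Proof.
apply: eq_big_nat => m /andP[m0 ms].
rewrite l2_formulaE//; first by rewrite subn_gt0.
- exact: cochain_multilinear.
- exact: cochain_multilinear.
- by rewrite subnKC// ltnW.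
Qed.

Lemma l2_linear_l (G : cochain A) : linear (fun F => l2 mul F G).
Proof.
move=> a F F'; apply/val_inj/funext => s.
rewrite -[RHS]/(a *: l2 mul F G s + l2 mul F' G s).
rewrite -[LHS]/(l2 mul (a *: F + F') G s) !l2_funE scaler_sumr -big_split.
apply: eq_bigr => m _.
rewrite -[cochain_val (a *: F + F')]/(a *: (F : seq A -> A) + F').
rewrite lie_linear_l; try exact: cochain_multilinear.
by rewrite !fctE scalerDr !scalerA mulrC.
Qed.

Lemma l2_linear_r (F : cochain A) : linear (l2 mul F).
Proof.
move=> a G G'; apply/val_inj/funext => s.
rewrite -[RHS]/(a *: l2 mul F G s + l2 mul F G' s).
rewrite -[LHS]/(l2 mul F (a *: G + G') s) !l2_funE scaler_sumr -big_split.
apply: eq_bigr => m _.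
rewrite -[cochain_val (a *: G + G')]/(a *: (G : seq A -> A) + G').
rewrite lie_linear_r; try exact: cochain_multilinear.
by rewrite !fctE scalerDr !scalerA mulrC.
Qed.

Lemma l2_0l G : l2 mul 0 G = 0.
Proof.
by have := l2_linear_l G (-1) 0 0; rewrite scaler0 addr0 scaleN1r addNr.
Qed.

Lemma l2_0r F : l2 mul F 0 = 0.
Proof.
by have := l2_linear_r F (-1) 0 0; rewrite scaler0 addr0 scaleN1r addNr.
Qed.

Lemma l2_degree m n F G : cochain_degree m%:Z F -> cochain_degree n%:Z G ->
  cochain_degree (m + n).+1%:Z (l2 mul F G).
Proof.
by move=> dF dG s ss; rewrite (l2_homE mul s dF dG); case: eqP => //; lia.
Qed.

Lemma l2_symmetric (d e : int) F G : cochain_degree d F -> cochain_degree e G ->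
  l2 mul G F = (-1) ^ (d * e) *: l2 mul F G.
Proof.
case: d e => [m|m] [n|n] dF dG;
  rewrite ?(cochain_degree_neg dF) ?(cochain_degree_neg dG) ?l2_0l ?l2_0r
    ?scaler0//.
apply/val_inj; rewrite -[RHS]/(_ *: (l2 mul F G : seq A -> A)).
rewrite -[LHS]/(l2 mul G F : seq A -> A) (l2_lie dF dG) (l2_lie dG dF).
rewrite lieC -PoszM -exprnP (mulnC n.+1 m) !signZE !(oddM, oddD)/=.
by case: (odd m); case: (odd n); rewrite /=; zmod.
Qed.

Lemma l2_l2_lie m n p F G H : cochain_degree m%:Z F -> cochain_degree n%:Z G ->
  cochain_degree p%:Z H ->
  l2 mul (l2 mul F G) H = (-1) ^+ ((m + n) * p + m.+1 * n) *:
    lie (m.+1 + n.+1) p.+1 (lie m.+1 n.+1 F G) H :> (seq A -> A).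
Proof.
move=> dF dG dH; rewrite (l2_lie (l2_degree dF dG) dH).
rewrite (l2_lie dF dG) lieZl; last exact: cochain_multilinear.
by rewrite addSn addnS !signZE !(oddM, oddD)/= !oddD !negbK;
  case: (odd m); case: (odd n); case: (odd p); rewrite /=; zmod.
Qed.

(** The Jacobi identity in its symmetric form: [lie_jacobi] with its two
    right-hand terms brought to the form l2(l2(_, _), _) by antisymmetry. *)
Lemma l2_jacobi (d e k : int) F G H :
  cochain_degree d F -> cochain_degree e G -> cochain_degree k H ->
  l2 mul (l2 mul F G) H + (-1) ^ (e * k) *: l2 mul (l2 mul F H) G
  + (-1) ^ (d * e + d * k) *: l2 mul (l2 mul G H) F = 0.
Proof.
case: d e k => [m|m] [n|n] [p|p] dF dG dH;
  rewrite ?(cochain_degree_neg dF) ?(cochain_degree_neg dG)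
    ?(cochain_degree_neg dH);
  rewrite ?l2_0l ?l2_0r ?l2_0l ?scaler0 ?addr0//.
apply/val_inj; rewrite -[LHS]/((l2 mul (l2 mul F G) H : seq A -> A) +
  _ *: (l2 mul (l2 mul F H) G : seq A -> A) +
  _ *: (l2 mul (l2 mul G H) F : seq A -> A)) -[RHS]/(0 : seq A -> A).
rewrite (l2_l2_lie dF dG dH) (l2_l2_lie dF dH dG) (l2_l2_lie dG dH dF).
rewrite lie_jacobi//;
  try exact: cochain_supported; try exact: cochain_multilinear.
rewrite (lieC m.+1 (_ + _)) (lieC n.+1 (_ + _)) -!PoszM -!PoszD -!exprnP.
rewrite !signZE !(oddM, oddD)/= ?(oddM, oddD)/= ?(oddM, oddD)/=.
by case: (odd m); case: (odd n); case: (odd p); rewrite /=; zmod.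
Qed.

(** With mu = id cup id one has mu |> _ = 0, since [mu, id] = 0, and
    g |> mu = [mu, g], since g |> _ is a derivation with id |-> - [g, id]; the
    two contributions to lie mu g cancel.  Associativity of A is what is used
    in both. *)
Lemma l2_l0 lambda (d : int) G :
  cochain_degree d G -> l2 mul (l0 mul lambda) G = 0.
Proof.
case: d => n dG; last by rewrite (cochain_degree_neg dG) l2_0r.
have d0 : cochain_degree 1%:Z (l0 mul lambda) by move=> [|x [|y [|z s]]].
apply/val_inj; rewrite -[LHS]/(l2 mul _ G : seq A -> A) (l2_lie d0 dG).
have -> : (l0 mul lambda : seq A -> A) = lambda *: cup 1 idc idc.
  apply/funext => -[|x [|y [|z s]]];
    rewrite fctE /cup /= ?linear0l ?linear0r ?scaler0//.
rewrite lieZl; last exact: cochain_multilinear.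
rewrite [lie _ _ _ _](_ : _ = 0) ?scaler0//.
have GU : act n.+1 G idc = - brk n.+1 1 G idc.
  apply: ins_idc => s ss; rewrite fctE brk_idc_supported ?oppr0//.
  exact: cochain_supported.
have -> : lie 2 n.+1 (cup 1 idc idc) G =
   - act n.+1 G (cup 1 idc idc) + brk 2 n.+1 (cup 1 idc idc) G.
  rewrite {1}/lie {1}/act /brk (cupA 1 1) muln1 sqrrN expr1n scale1r subrr.
  rewrite oppr0 ins0l ?signZE ?oddM ?add0r//; exact: cochain_multilinear.
rewrite act_cup GU /brk !cup_lin !(cupA_sym) !(cupA 1) !signZE !oddM /=.
by case: (odd n); rewrite /=; zmod.
Qed.
End Cochains.

(** * Shuffles and Koszul signs in low degree *)

Lemma size_image_ord (T : Type) n (x : 'I_n -> T) :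
  size [seq x j | j : 'I_n] = n.
Proof. by rewrite size_map -cardE card_ord. Qed.

Local Notation o0 := (@Ordinal 3 0 isT).
Local Notation o1 := (@Ordinal 3 1 isT).
Local Notation o2 := (@Ordinal 3 2 isT).

Lemma enum_ord2 : enum 'I_2 = [:: ord0; ord_max].
Proof. by apply: (inj_map val_inj); rewrite val_enum_ord. Qed.

Lemma enum_ord3 : enum 'I_3 = [:: o0; o1; o2].
Proof. by apply: (inj_map val_inj); rewrite val_enum_ord. Qed.

Lemma ord3P (i : 'I_3) : [\/ i = o0, i = o1 | i = o2].
Proof.
by case: i => [[|[|[|//]]] ?];
  [constructor 1|constructor 2|constructor 3]; apply: val_inj.
Qed.

Lemma is_shuffle21 (s : 'S_3) : is_shuffle 2 s = (s o0 < s o1)%N.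
Proof.
apply/forallP/idP => [/(_ o0)/forallP/(_ o1)//|s01 a]; apply/forallP => b.
by apply/implyP; case: (ord3P a) => ->; case: (ord3P b) => ->.
Qed.

(** The (2,1)-shuffles of 3 elements are the identity, the transposition of the
    last two, and the cycle 0 -> 1 -> 2 -> 0. *)
Lemma sum_shuffle21 (V : nmodType) (Q : 'I_3 -> 'I_3 -> 'I_3 -> V) :
  \sum_(s : 'S_3 | is_shuffle 2 s) Q (s o0) (s o1) (s o2) =
  Q o0 o1 o2 + Q o0 o2 o1 + Q o1 o2 o0.
Proof.
have permE3 (s t : 'S_3) : s o0 = t o0 -> s o1 = t o1 -> s o2 = t o2 -> s = t.
  by move=> e0 e1 e2; apply/permP => i; case: (ord3P i) => ->.
pose c := (tperm o0 o1 * tperm o0 o2)%g.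
have cE : c o0 = o1 /\ c o1 = o2 /\ c o2 = o0.
  by rewrite !permM !permE /=.
have [c0 [c1 c2]] := cE.
have [t0 [t1 t2]] : tperm o1 o2 o0 = o0 /\ tperm o1 o2 o1 = o2 /\
    tperm o1 o2 o2 = o1 by rewrite !permE.
have neqE (s t : 'S_3) i : s i != t i -> s != t by apply: contraNneq => ->.
have sP (s : 'S_3) : (s o0 < s o1)%N -> s != 1%g -> s != tperm o1 o2 -> s == c.
  have inj i j : s i = s j -> i = j := @perm_inj _ s i j.
  case: (ord3P (s o0)) => e0; case: (ord3P (s o1)) => e1;
    case: (ord3P (s o2)) => e2; rewrite e0 e1 // => _;
    try by [have := inj o0 o2; rewrite e0 e2 => /(_ erefl)
           |have := inj o1 o2; rewrite e1 e2 => /(_ erefl)].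
  - by move=> /eqP[]; apply: permE3; rewrite perm1.
  - by move=> _ /eqP[]; apply: permE3; rewrite ?e0 ?e1 ?e2 ?t0 ?t1 ?t2.
  - by move=> _ _; apply/eqP/permE3; rewrite ?e0 ?e1 ?e2 ?c0 ?c1 ?c2.
rewrite (bigD1 1%g) ?is_shuffle21 ?perm1//= (bigD1 (tperm o1 o2)); last first.
  by rewrite is_shuffle21 t0 t1 /=; apply: (neqE _ _ o1); rewrite t1 perm1.
rewrite (big_pred1 c) => [|s]; first by rewrite t0 t1 t2 c0 c1 c2 -[RHS]addrA.
rewrite is_shuffle21; apply/idP/eqP => [/andP[/andP[s01 s1] st]|->].
  exact/eqP/sP.
by rewrite c0 c1 /=; apply/andP; split; apply: (neqE _ _ o0);
  rewrite c0 ?perm1 ?t0.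
Qed.

Lemma koszul_sign3 (K : fieldType) (d : 'I_3 -> int) (s : 'S_3) :
  koszul_sign K d s =
  (if (s o1 < s o0)%N then (-1) ^ (d (s o0) * d (s o1)) else 1) *
  (if (s o2 < s o0)%N then (-1) ^ (d (s o0) * d (s o2)) else 1) *
  (if (s o2 < s o1)%N then (-1) ^ (d (s o1) * d (s o2)) else 1).
Proof.
rewrite /koszul_sign.
under eq_bigr do rewrite big_mkcond !big_ord_recl big_ord0.
rewrite !big_ord_recl big_ord0 /= !mulr1 !mul1r.
have -> : lift ord0 ord0 = o1 by apply: val_inj.
have -> : lift ord0 (lift ord0 ord0) = o2 by apply: val_inj.
by have -> : ord0 = o0 by apply: val_inj.
Qed.

Lemma koszul_sign2 (K : fieldType) (d : 'I_2 -> int) (s : 'S_2) :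
  koszul_sign K d s =
  if (s ord_max < s ord0)%N then (-1) ^ (d (s ord0) * d (s ord_max)) else 1.
Proof.
rewrite /koszul_sign.
under eq_bigr do rewrite big_mkcond !big_ord_recl big_ord0.
rewrite !big_ord_recl big_ord0 /= !mulr1 mul1r.
by have -> : lift ord0 ord0 = ord_max :> 'I_2 by apply: val_inj.
Qed.

(** * The curved L-infinity structure and its Maurer-Cartan elements *)

Section Grading.
Variables (K : fieldType) (A : lmodType K).
Implicit Types F G : cochain A.

Lemma cochain_sumE (I : Type) (r : seq I) (c : I -> cochain A) s :
  (\sum_(i <- r) c i : cochain A) s = \sum_(i <- r) c i s.
Proof. exact: (big_morph (fun F : cochain A => F s)). Qed.

Lemma component_is_cochain (n : nat) F :
  is_cochain (fun s => if size s == n then F s else 0).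
Proof.
have [mF F0 _] := cochainP F.
split=> [s t a u v||]; first 1 last.
- by rewrite F0; case: ifP.
- by exists n => s ns; rewrite gtn_eqF.
by rewrite !size_cat /=; case: ifP => _; rewrite ?mF ?scaler0 ?addr0.
Qed.

Definition component n F : cochain A := mk_cochain (component_is_cochain n F).

Lemma cochain_grading : is_grading (@cochain_degree K A).
Proof.
split=> [//|d a F G dF dG s sd|F|r c r_uniq dc sum0 d dr].
- by rewrite -[LHS]/(a *: F s + G s) dF// dG// scaler0 addr0.
- have [_ F0 [N FN]] := cochainP F.
  exists [seq Posz n | n <- iota 0 N].
  exists (fun d => if d is Posz n then component n.+1 F else 0).
  split=> [[n|n] s ss //=|].
    by rewrite ifF//; apply/eqP => e; apply: ss; lia.
  apply/val_inj/funext => s; rewrite -[LHS]/(F s) -[RHS]/(cochain_val _ s).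
  rewrite cochain_sumE big_map /=; case: s => [|x s]; first by rewrite big1.
  have [sN|Ns] := ltnP (size s) N; last first.
    rewrite FN// big_seq big1// => n; rewrite mem_iota => /andP[_ nN].
    by rewrite ifF//=; apply/negbTE; lia.
  rewrite (bigD1_seq (size s)) ?iota_uniq ?mem_iota//= eqxx.
  rewrite big1 ?addr0// => n ns; by rewrite ifF// eqSS eq_sym (negbTE ns).
- apply/val_inj/funext => s; rewrite -[RHS]/(0 : A) -[LHS]/(c d s).
  have [sd|sd] := eqVneq (size s)%:Z (d + 1); last by apply: dc; apply/eqP.
  have := congr1 (fun F : cochain A => F s) sum0.
  rewrite -[X in _ = X]/(0 : A) cochain_sumE (bigD1_seq d)//=.
  rewrite big1 ?addr0// => e ed; apply: dc => se;
  by move/eqP: ed; apply; apply: (addIr 1); rewrite -se -sd.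
Qed.
End Grading.

Section Main.
Variables (K : fieldType) (A : lmodType K).
Variable mul : {bilinear A -> A -> A}.
Hypothesis mulA : associative mul.
Variable lambda : K.
Implicit Types F G H : cochain A.
Local Notation l := (mrb_brackets mul lambda).
Local Notation gr := (@cochain_degree K A).

Lemma brackets_eq0 xs : size xs != 0%N -> size xs != 2%N -> l xs = 0.
Proof. by case: xs => [|x [|y [|z xs]]]. Qed.

Lemma brackets_multilinear : multilinear l.
Proof.
move=> [|x [|y [|z s]]] t a u v /=; rewrite ?scaler0 ?addr0//.
  by case: t => [|y [|z t]] /=; rewrite ?scaler0 ?addr0// l2_linear_l.
by case: t => [|z t] /=; rewrite ?scaler0 ?addr0// l2_linear_r.
Qed.

Lemma l2_degree_int d e F G : gr d F -> gr e G -> gr (d + e + 1) (l2 mul F G).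
Proof.
case: d e => [m|m] [n|n] dF dG;
  rewrite ?(cochain_degree_neg dF) ?(cochain_degree_neg dG) ?l2_0l ?l2_0r//.
by rewrite -PoszD -PoszD addn1; apply: l2_degree.
Qed.

Lemma brackets_degree n (x : 'I_n -> cochain A) (d : 'I_n -> int) :
  (forall j, gr (d j) (x j)) ->
  gr (\sum_(j < n) d j + 1) (l [seq x j | j : 'I_n]).
Proof.
move=> dx; have sz := size_image_ord x.
have [n0|n0] := eqVneq n 0%N.
  subst n; rewrite big_ord0 (size0nil sz) => -[|a [|b [|c s]]]//.
have [n2|n2] := eqVneq n 2%N; last by rewrite brackets_eq0 ?sz.
subst n; rewrite /image_mem enum_ord2 /= big_ord_recl big_ord1.
have -> : lift ord0 ord0 = ord_max :> 'I_2 by apply: val_inj.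
exact: l2_degree_int.
Qed.

Lemma brackets_symmetric n (x : 'I_n -> cochain A) (d : 'I_n -> int)
    (s : 'S_n) :
  (forall j, gr (d j) (x j)) ->
  l [seq x (s j) | j : 'I_n] = koszul_sign K d s *: l [seq x j | j : 'I_n].
Proof.
move=> dx; have sz := size_image_ord x.
have szs := size_image_ord (fun j => x (s j)).
have [n0|n0] := eqVneq n 0%N.
  subst n; rewrite (size0nil sz) (size0nil szs).
  by rewrite /koszul_sign big_ord0 scale1r.
have [n2|n2] := eqVneq n 2%N; last by rewrite !brackets_eq0 ?sz ?szs// scaler0.
subst n; rewrite koszul_sign2 /image_mem enum_ord2 /=.
have ord2P (i : 'I_2) : i = ord0 \/ i = ord_max.
  by case: i => [[|[|//]] ?]; [left|right]; apply: val_inj.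
have s01 : s ord0 <> s ord_max by move/perm_inj.
case: (ord2P (s ord0)) (ord2P (s ord_max)) s01 => [->|->] [->|->] //= _.
  by rewrite scale1r.
by rewrite mulrC (l2_symmetric mul (dx ord0) (dx ord_max)).
Qed.

(** The term l(l(first i), the other n - i) vanishes unless n - i = 1, for the
    outer bracket to be l2, and i is 0 or 2, for the inner one to be l0 or l2.
    So only n = 1 and n = 3 remain. *)
Lemma brackets_relation n (x : 'I_n -> cochain A) (d : 'I_n -> int) :
  (forall j, gr (d j) (x j)) ->
  \sum_(i < n.+1) \sum_(s : 'S_n | is_shuffle i s)
     koszul_sign K d s *:
       (let y := [seq x (s j) | j : 'I_n] in
        l (l (take i y) :: drop i y)) = 0.
Proof.
move=> dx; have szy (s : 'S_n) := size_image_ord (fun j => x (s j)).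
have outer0 (i : 'I_n.+1) (s : 'S_n) : i.+1 != n ->
    let y := [seq x (s j) | j : 'I_n] in l (l (take i y) :: drop i y) = 0.
  move=> i1n y; apply: brackets_eq0 => //=; rewrite size_drop szy.
  by have := ltn_ord i; lia.
have inner0 (i : 'I_n.+1) (s : 'S_n) : i != 0%N :> nat -> i != 2%N :> nat ->
    let y := [seq x (s j) | j : 'I_n] in l (l (take i y) :: drop i y) = 0.
  move=> i0 i2 y; have szi : size (take i y) = i.
    by rewrite size_takel// szy -ltnS.
  rewrite (brackets_eq0 (xs := take _ _)) ?szi//.
  by case: (drop i y) => [|F [|? ?]] //=; rewrite l2_0l.
have [n3|n3] := eqVneq n 3%N.
  subst n; pose i2 := @Ordinal 4 2 isT.
  rewrite (bigD1 i2)//= [X in _ + X]big1 ?addr0 => [|i i_neq2]; last first.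
    by rewrite big1// => s _; rewrite [X in _ *: X]outer0 ?scaler0//.
  rewrite /image_mem enum_ord3.
  under eq_bigr do rewrite koszul_sign3 /=.
  rewrite (sum_shuffle21 (fun a b c =>
   ((if (b < a)%N then (-1) ^ (d a * d b) else 1) *
    (if (c < a)%N then (-1) ^ (d a * d c) else 1) *
    (if (c < b)%N then (-1) ^ (d b * d c) else 1)) *:
     l2 mul (l2 mul (x a) (x b)) (x c))) /= !mul1r scale1r.
  have /= := l2_jacobi mulA (dx o0) (dx o1) (dx o2).
  rewrite expfzDr ?oppr_eq0 ?oner_eq0//.
  by rewrite (mulrC (d o1) (d o2)) !(mulrC (d o0)).
rewrite big1// => i _; rewrite big1// => s _.
have [i1|i1] := eqVneq i.+1 n; last by rewrite [X in _ *: X]outer0 ?scaler0.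
have [i0|i0] := eqVneq (i : nat) 0%N; last first.
  by rewrite [X in _ *: X]inner0 ?scaler0//; apply: contra_neq n3 => i2; lia.
have n1 : n = 1%N by rewrite -i1 i0.
subst n; cbv zeta; rewrite i0 take0 drop0 /image_mem.
have -> : enum 'I_1 = [:: ord0].
  by apply: (inj_map val_inj); rewrite val_enum_ord.
by rewrite /= (l2_l0 mulA lambda (dx _)) scaler0.
Qed.

Lemma brackets_curved_Linfty : curved_Linfty gr l.
Proof.
split.
- exact: cochain_grading.
- exact: brackets_multilinear.
- exact: brackets_degree.
- exact: brackets_symmetric.
- exact: brackets_relation.
Qed.

Lemma l2_cochain1 (D : {linear A -> A}) u v :
  l2 mul (cochain1 D) (cochain1 D) [:: u; v] =
  (mul (D u) (D v) - D (mul u (D v)) - D (mul (D u) v)) *+ 2.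
Proof.
have dD : gr 0 (cochain1 D) by move=> [|a [|b s]].
rewrite (l2_homE mul _ dD dD) /= /l2_formula !big_nat1 /segment /entry /=.
rewrite !expr1 !expr0 mulrNN ?mul1r ?mulr1 !scale1r !scaleN1r mulr2n; zmod.
Qed.

(** The Maurer-Cartan sum does not depend on the cut-off N, even when N < 3:
    the hypothesis then says that the missing terms are zero. *)
Lemma mc_sum (x : cochain A) N : (forall k, (N <= k)%N -> l (nseq k x) = 0) ->
  \sum_(k < N) (k`!%:R : K)^-1 *: l (nseq k x) =
  l0 mul lambda + 2^-1 *: l2 mul x x.
Proof.
move=> lN; pose f k := (k`!%:R : K)^-1 *: l (nseq k x).
(* Both N and 3 are valid cut-offs, hence so is N + 3. *)
have e1 : \sum_(k < N + 3) f k = \sum_(k < N) f k.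
  rewrite big_split_ord /= [X in _ + X]big1 ?addr0// => i _.
  by rewrite /f lN ?scaler0// leq_addr.
rewrite -[LHS]e1 addnC big_split_ord /= [X in _ + X]big1 ?addr0; last first.
  by move=> i _; rewrite /f brackets_eq0 ?scaler0// size_nseq.
by rewrite !big_ord_recr big_ord0 /= /f /= add0r invr1 scale1r scaler0 addr0.
Qed.

Lemma maurer_cartan_brackets (charK0 : [pchar K] =i pred0) (x : cochain A) :
  maurer_cartan gr l x <->
  exists2 D : {linear A -> A},
    modified_rota_baxter mul lambda D & x = cochain1 D.
Proof.
have two0 : (2 : K) != 0 by rewrite pcharf0P in charK0; rewrite charK0.
have half (w : A) : (2^-1 : K) *: (w *+ 2) = w.
  by rewrite -scaler_nat scalerA mulVf// scale1r.
split=> [[dx [N [lN]]]|[D mrb ->]].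
  rewrite mc_sum// => mc.
  pose D u := x [:: u].
  have linD : linear D by exact: (cochain_multilinear x [::] [::]).
  pose D' : {linear A -> A} :=
    HB.pack D (GRing.isLinear.Build K A A *:%R D linD).
  have xD : x = cochain1 D'.
    apply/val_inj/funext => -[|a [|b s]] //=; apply: dx => /=; lia.
  exists D' => // u v; have := congr1 (fun F : cochain A => F [:: u; v]) mc.
  rewrite -[X in X = _ -> _]/(lambda *: mul u v + 2^-1 *: l2 mul x x [:: u; v]).
  rewrite xD l2_cochain1 half -[X in _ = X -> _]/(0 : A).
  by move/eqP; rewrite addr_eq0 => /eqP ->; rewrite opprK.
have dD : gr 0 (cochain1 D) by move=> [|a [|b s]].
split=> //; exists 3; have l3 k : (3 <= k)%N -> l (nseq k (cochain1 D)) = 0.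
  by move=> k3; rewrite brackets_eq0// size_nseq; lia.
split=> //; rewrite mc_sum//; apply/val_inj/funext => s.
rewrite -[LHS]/(l0 mul lambda s + 2^-1 *: l2 mul (cochain1 D) (cochain1 D) s).
rewrite -[RHS]/(0 : A).
case: s => [|u [|v [|w s]]]; try by
  rewrite (l2_homE mul _ dD dD) /= scaler0 addr0.
by rewrite l2_cochain1 half mrb subrr.
Qed.
End Main.

Theorem corollary3p16 (K : fieldType) (charK0 : [pchar K] =i pred0)
    (A : lmodType K) (mul : {bilinear A -> A -> A}) (mulA : associative mul)
    (lambda : K) :
  curved_Linfty (@cochain_degree K A) (mrb_brackets mul lambda) /\
  forall x : cochain A,
    maurer_cartan (@cochain_degree K A) (mrb_brackets mul lambda) x <->
    exists2 D : {linear A -> A},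
      modified_rota_baxter mul lambda D & x = cochain1 D.
Proof.
split; first exact: brackets_curved_Linfty.
exact: maurer_cartan_brackets.
Qed.
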